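(* Let $H\in(0,1)$, let $(B^H_t)_{t\ge 0}$ be a fractional Brownian motion with Hurst parameter $H$, let $x_0\in\mathbb{R}$, and let $\sigma\in C^\infty(\mathbb{R})$ have bounded derivatives of all orders, with $\sigma(x)\neq 0$ for all $x\in\mathbb{R}$ (so that $\sigma^2:\mathbb{R}\to(0,\infty)$). Let $X=(X_t)_{t\ge0}$ be the solution of $dX_t=\sigma(X_t)\circ dB^H_t$ with $X_0=x_0$. Then for every $t>0$, $$\frac{d}{dt}h(X_t)=Ht^{2H-1}\Big\{J_{\sigma^2}(X_t)-\mathbb{E}\big[(\sigma^2)''(X_t)\big]+\mathbb{E}\big[\sigma''(X_t)\sigma(X_t)+(\sigma'(X_t))^2\big]\Big\},$$ where $h$ is the Shannon entropy and $J_{\sigma^2}$ is the generalized Fisher information with respect to $\sigma^2$.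
   Context: A fractional Brownian motion $(B^H_t)_{t\ge0}$ with Hurst parameter $H\in(0,1)$ is a centered Gaussian process with stationary increments and covariance $\mathbb{E}[B^H_sB^H_t]=\tfrac12(t^{2H}+s^{2H}-|t-s|^{2H})$. The equation $dX_t=\sigma(X_t)\circ dB^H_t$, $X_0=x_0$, is understood in the pathwise sense (Young integral for $H\in(1/2,1)$, rough path integral for $H\in(1/4,1)$, symmetric integral for $H\in(1/6,1)$, $m$-order Newton-Cotes functional for general $H\in(0,1)$). Its unique solution is $X_t=\varphi(B^H_t)$, where $\varphi:\mathbb{R}\to\mathbb{R}$ solves the ordinary differential equation $\varphi'(x)=\sigma(\varphi(x))$, $\varphi(0)=x_0$. For a random variable $X$ with probability density $f_X$, the Shannon entropy is $h(X):=-\mathbb{E}[\ln f_X(X)]=-\int_{\mathbb{R}}f_X(x)\ln f_X(x)\,dx$. For a function $b:\mathbb{R}\to(0,\infty)$, the generalized Fisher information with respect to $b$ is $J_b(X):=\mathbb{E}\big[b(X)\big(\tfrac{\partial}{\partial x}\ln f_X(X)\big)^2\big]$, where the derivative of $\ln f_X$ is evaluated at $X$. *)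

(* Defs.v *)
From HB Require Import structures.
From mathcomp Require Import all_boot all_order all_algebra.
From mathcomp Require Import all_classical all_reals all_analysis.
Import Order.TTheory GRing.Theory Num.Theory.
Import numFieldNormedType.Exports.

Set Implicit Arguments.
Unset Strict Implicit.
Unset Printing Implicit Defensive.

Local Open Scope ring_scope.
Local Open Scope classical_set_scope.

(* One-dimensional Gaussian law, possibly degenerate.  The variance-zero case
   has to be a Dirac mass: by convention [normal_prob m 0] is the uniform law
   on [0, 1]. *)
Definition gaussian_law (R : realType) (mu : set R -> \bar R) : Prop :=
  (exists m s : R, s != 0 /\
     forall A : set R, measurable A -> mu A = normal_prob m s A) \/
  (exists c : R, forall A : set R, measurable A -> mu A = \d_c A).

(* Processes are indexed by all of [R]; only times [t >= 0] are constrained. *)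

Definition gaussian_process d (T : measurableType d) (R : realType)
    (P : probability T R) (B : R -> {RV P >-> R}) : Prop :=
  forall (n : nat) (t c : 'I_n -> R), (forall i, 0 <= t i) ->
    gaussian_law (pushforward P (fun w => \sum_(i < n) c i * B (t i) w)).

Definition centered d (T : measurableType d) (R : realType)
    (P : probability T R) (B : R -> {RV P >-> R}) : Prop :=
  forall t : R, 0 <= t -> ('E_P[B t])%E = 0%E.

(* The finite-dimensional laws of [t |-> B (s + t) - B s] do not depend on
   [s]; they are compared on measurable rectangles. *)
Definition stationary_increments d (T : measurableType d) (R : realType)
    (P : probability T R) (B : R -> {RV P >-> R}) : Prop :=
  forall (n : nat) (s : R) (t : 'I_n -> R) (A : 'I_n -> set R),
    0 <= s -> (forall i, 0 <= t i) -> (forall i, measurable (A i)) ->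
    P [set w | forall i, A i (B (s + t i) w - B s w)] =
    P [set w | forall i, A i (B (t i) w - B 0 w)].

Definition fractional_brownian_motion d (T : measurableType d) (R : realType)
    (P : probability T R) (H : R) (B : R -> {RV P >-> R}) : Prop :=
  [/\ gaussian_process B, centered B, stationary_increments B &
      forall s t : R, 0 <= s -> 0 <= t ->
        ('E_P[fun w => (B s w * B t w)%R])%E =
        ((t `^ (2 * H) + s `^ (2 * H) - `|t - s| `^ (2 * H)) / 2)%:E].

Definition smooth (R : realType) (f : R -> R) : Prop :=
  forall (n : nat) (x : R), derivable (f^`(n)) x 1.

(* The derivatives of order at least 1 are bounded; [f] itself need not be. *)
Definition bounded_derivatives (R : realType) (f : R -> R) : Prop :=
  forall n : nat, (0 < n)%N -> exists M : R, forall x : R, `|f^`(n) x| <= M.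

(* The solution of [dX = sigma(X) o dB], [X 0 = x0], in the pathwise sense:
   [X t = phi (B t)] for all [t >= 0], almost surely, where [phi] solves the
   ordinary differential equation [phi' = sigma(phi)], [phi 0 = x0]. *)
Definition fbm_sde_solution d (T : measurableType d) (R : realType)
    (P : probability T R) (sigma : R -> R) (x0 : R)
    (B X : R -> {RV P >-> R}) : Prop :=
  exists phi : R -> R,
    [/\ phi 0 = x0,
        forall x : R, is_derive x (1 : R) phi (sigma (phi x)) &
        {ae P, forall w, forall t : R, 0 <= t -> X t w = phi (B t w)}].

Definition has_density d (T : measurableType d) (R : realType)
    (P : probability T R) (X : {RV P >-> R}) (f : R -> R) : Prop :=
  [/\ measurable_fun setT f, forall x, 0 <= f x &
      forall A : set R, measurable A ->
        distribution P X A = (\int[lebesgue_measure]_(x in A) (f x)%:E)%E].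

(* A density is only determined up to null sets, whereas the Fisher information
   differentiates its logarithm pointwise.  There is at most one density that
   is differentiable everywhere. *)
Definition has_regular_density d (T : measurableType d) (R : realType)
    (P : probability T R) (X : {RV P >-> R}) (f : R -> R) : Prop :=
  has_density X f /\ forall x : R, 0 < f x /\ derivable f x 1.

Definition shannon_entropy d (T : measurableType d) (R : realType)
    (P : probability T R) (X : {RV P >-> R}) (f : R -> R) : \bar R :=
  (- 'E_P[fun w => ln (f (X w))])%E.

Definition fisher_information d (T : measurableType d) (R : realType)
    (P : probability T R) (b : R -> R) (X : {RV P >-> R}) (f : R -> R)
    : \bar R :=
  ('E_P[fun w => (b (X w) * ((fun x => ln (f x))^`()%classic (X w)) ^+ 2)%R])%E.

(* Main.v *)
Require Import Defs.
From HB Require Import structures.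
From mathcomp Require Import all_boot all_order all_algebra.
From mathcomp Require Import all_classical all_reals all_analysis.
From mathcomp Require Import measurable_realfun ring.
Import Order.TTheory GRing.Theory Num.Theory.
Import numFieldNormedType.Exports.
Set Implicit Arguments.
Unset Strict Implicit.
Unset Printing Implicit Defensive.
Local Open Scope ring_scope.
Local Open Scope classical_set_scope.

(** Why the identity holds.  Suppose first that [sigma > 0].  The flow [phi] is
    then an increasing bijection with inverse [psi], [psi' = 1 / sigma], and
    [X t = phi (B t)] where [B t] is centered Gaussian with standard deviation
    [s = t ^ H].  The change of variables [x = phi y] gives the density of
    [X t] in closed form:
      [ln f_t x = ln p_s (psi x) - ln (sigma x)],
    where [p_s] is the Gaussian density ([has_density_comp_increasing]).  A
    density that is differentiable everywhere is continuous, and continuous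
    densities are unique, so the formula is about these functions [f_t]
    ([solution_density_unique]).  Put [G = ln (sigma (phi y))]; the flow
    equation makes its derivatives explicit: [G' = sigma' (phi y)], which is
    bounded, and [G'' = (sigma'' sigma) (phi y)].

    Entropy.  [h (X t) = - ln (normal_peak s) + 1/2 + E (G (B t))].  Any
    multiple of [B t] is again Gaussian, so [B r] has the law of
    [(r / t) ^ H B t] and only one random variable occurs when differentiating
    in [r]; the derivative passes under the expectation because [G'] is
    bounded.  The result is
      [h' = H/t (1 + E (B t * G' (B t))) = H t^(2H-1) (1/s^2 + E (G'' (B t)))],
    the last step being Gaussian integration by parts,
      [E (Y F (Y)) = s^2 E (F' (Y))]  ([gaussian_stein]).

    Fisher information.  [sigma (X t) (ln f_t)' (X t)] equals
    [- (B t / s^2 + sigma' (X t))].  Squaring, and using integration by parts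
    for the cross term, [J = 1/s^2 + 2 E (sigma'' sigma) + E (sigma'^2)].  As
    [(sigma^2)'' = 2 sigma'' sigma + 2 sigma'^2], the right-hand side of the
    formula collapses to the expression found for [h'].

    Integrability is never an issue: [G'] is bounded, hence [sigma o phi] grows
    at most exponentially, and such functions are integrable against any
    Gaussian law; this is the role of [exp_bounded].

    Sign.  A continuous [sigma] without zeros has a constant sign [eps].
    Replacing [sigma], [phi], [B] by [eps sigma], [phi (eps .)], [eps B]
    changes neither [X] nor any term of the formula, and reduces the general
    case to [sigma > 0]. *)

(** * Integration against a density *)

Lemma is_derive_continuous (R : realType) (f df : R -> R) :
  (forall x, is_derive x (1 : R) f (df x)) -> continuous f.
Proof.
by move=> dfE x; apply/differentiable_continuous/derivable1_diffP.
Qed.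

Section density.
Context d (T : measurableType d) (R : realType) (P : probability T R).
Implicit Types (X Y : {RV P >-> R}) (f g p F : R -> R).

Local Notation mu := (@lebesgue_measure R).

Lemma measurable_to_borel X : measurable_fun setT (X : T -> measurableTypeR R).
Proof. by move=> A B mB; exact: (@measurable_funPT _ _ _ _ X A B mB). Qed.

(** Lebesgue measure lives on [measurableTypeR R], whereas [distribution P X]
    lives on [R] with its default measurable structure.  The two sigma-algebras
    are convertible, and [law X] transports the distribution to the former so
    that both measures can be compared. *)
Definition law X : probability (measurableTypeR R) R :=
  distribution P (MeasurableFun.Pack (MeasurableFun.Class
    (isMeasurableFun.Build _ _ T (measurableTypeR R) X
      (measurable_to_borel X)))).

Lemma density_integrable X f :
  has_density X f -> mu.-integrable setT (EFin \o f).
Proof.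
move=> [mf f0 Xf]; apply/integrableP; split; first exact/measurable_EFinP.
under eq_integral do rewrite /= ger0_norm//.
by rewrite -(Xf _ measurableT) (le_lt_trans (probability_le1 _ _)) ?ltry.
Qed.

(** The law of [X] is dominated by Lebesgue measure and its Radon-Nikodym
    derivative is almost everywhere [f], because both have the same integral
    over every measurable set. *)
Lemma ge0_integral_density X f (F : R -> \bar R) :
  has_density X f -> measurable_fun setT F -> (forall y, (0 <= F y)%E) ->
  (\int[P]_w F (X w) = \int[mu]_y (F y * (f y)%:E))%E.
Proof.
move=> Xf mF F0; have [mf f0 Xf_] := Xf.
pose D := law X.
transitivity (\int[D]_y F y)%E.
  by rewrite /D/law ge0_integral_distribution.
have dom : D `<< mu.
  apply/null_content_dominatesP => A mA A0.
  rewrite [LHS]Xf_//; apply: null_set_integral => //.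
  by apply/measurable_funTS/measurable_EFinP.
rewrite -(Radon_Nikodym_SigmaFinite.change_of_variables dom)//.
apply: ae_eq_integral => //.
- apply: emeasurable_funM => //.
  exact: measurable_int (Radon_Nikodym_SigmaFinite.f_integrable dom).
- by apply: emeasurable_funM => //; exact/measurable_EFinP.
- apply: ae_eqe_mul2l; apply: integral_ae_eq => //.
  + exact: Radon_Nikodym_SigmaFinite.f_integrable.
  + exact/measurable_EFinP.
  + move=> A _ mA; rewrite -Radon_Nikodym_SigmaFinite.f_integral//.
    exact: Xf_.
Qed.

Lemma integrable_density X f F : has_density X f -> measurable_fun setT F ->
  mu.-integrable setT (fun y => (F y * f y)%:E) ->
  P.-integrable setT (fun w => (F (X w))%:E).
Proof.
move=> Xf mF /integrableP[_ iF]; have [mf f0 _] := Xf.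
apply/integrableP; split.
  by apply/measurable_EFinP; exact: (measurableT_comp mF).
move: iF; apply: le_lt_trans; rewrite le_eqVlt; apply/orP; left; apply/eqP.
rewrite (ge0_integral_density (f := f) (F := fun y => `|(F y)%:E|%E))//.
  by apply: eq_integral => y _; rewrite /= -EFinM normrM (ger0_norm (f0 y)).
by apply: measurableT_comp => //; exact/measurable_EFinP.
Qed.

Lemma integral_density X f F : has_density X f -> measurable_fun setT F ->
  mu.-integrable setT (fun y => (F y * f y)%:E) ->
  \int[P]_w F (X w) = \int[mu]_y (F y * f y).
Proof.
move=> Xf mF iF; have [mf f0 _] := Xf.
rewrite /Rintegral; congr fine.
rewrite [LHS]integralE [RHS]integralE.
have mEF : measurable_fun setT (fun y => (F y)%:E) by exact/measurable_EFinP.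
congr (_ - _)%E.
  transitivity (\int[P]_w ((fun y => (F y)%:E)^\+ (X w)))%E.
    by apply: eq_integral => w _; rewrite funepos.unlock.
  rewrite (ge0_integral_density (f := f))//; last exact: measurable_funepos.
  apply: eq_integral => y _.
  by rewrite funepos.unlock EFinM maxe_pMl ?lee_fin// mul0e.
transitivity (\int[P]_w ((fun y => (F y)%:E)^\- (X w)))%E.
    by apply: eq_integral => w _; rewrite funeneg.unlock.
rewrite (ge0_integral_density (f := f))//; last exact: measurable_funeneg.
apply: eq_integral => y _.
by rewrite funeneg.unlock EFinM -mulNe maxe_pMl ?lee_fin// mul0e.
Qed.

(** * Uniqueness and change of variables for densities *)

(** Both densities are the derivative of the same distribution function. *)
Lemma continuous_density_unique X f g : has_density X f -> has_density X g ->
  continuous f -> continuous g -> f =1 g.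
Proof.
move=> Xf Xg cf cg x.
have FTC k : has_density X k -> continuous k ->
    (fun y => fine (distribution P X `]-oo, y]))^`()%classic x = k x.
  move=> Xk ck; have [mk k0 Xk_] := Xk.
  have ik : mu.-integrable `]-oo, (x + 1)] (EFin \o k).
    apply: (integrableS measurableT) => //; exact: density_integrable Xk.
  have xx1 : x < x + 1 by rewrite ltrDl.
  have ax : (-oo%O < BRight x)%E by rewrite ltNyr.
  have [_ <-] := @continuous_FTC1 R k -oo%O x (x + 1) xx1 ik ax (ck x).
  rewrite (_ : (fun y => _) = (fun y => \int[mu]_(t in `]-oo, y]) k t))//.
  by apply/funext => y; rewrite Xk_.
by rewrite -(FTC f)// (FTC g).
Qed.

Lemma ae_measure_eq (A B : set T) : measurable A -> measurable B ->
  {ae P, forall w, A w <-> B w} -> P A = P B.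
Proof.
move=> mA mB AB; rewrite -[A]setIT -[B]setIT -!integral_indic//.
apply: ae_eq_integral => //; [exact/measurable_EFinP|exact/measurable_EFinP|].
apply: filterS AB => w AB _; congr EFin; rewrite !indicE.
congr (nat_of_bool _)%:R.
by apply/idP/idP; rewrite !inE => /AB.
Qed.

(** On an interval [`]a, b]] this is integration by substitution, since
    [X \in `]a, b]] means [Y \in `]psi a, psi b]]; such intervals determine a
    finite Borel measure. *)
Lemma has_density_comp_increasing X Y p (psi dpsi : R -> R) :
  has_density Y p -> continuous p ->
  {ae P, forall w, Y w = psi (X w)} ->
  {homo psi : x y / x < y} ->
  (forall x, is_derive x (1 : R) psi (dpsi x)) -> continuous dpsi ->
  (forall x, 0 <= dpsi x) ->
  has_density X (fun x => p (psi x) * dpsi x).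
Proof.
move=> Yp cp YX psi_incr dpsiE cdpsi dpsi0; have [mp p0 Yp_] := Yp.
have cpsi : continuous psi by exact: is_derive_continuous dpsiE.
have cf : continuous (fun x => p (psi x) * dpsi x).
  move=> x; apply: cvgM; last exact: cdpsi.
  by apply: continuous_comp; [exact: cpsi|exact: cp].
have mf := continuous_measurable_fun cf.
have f0 x : 0 <= p (psi x) * dpsi x by rewrite mulr_ge0.
have psiE : psi^`()%classic = dpsi.
  by apply/funext => x; rewrite derive1E derive_val.
split => //.
pose nu (A : set (measurableTypeR R)) : \bar R :=
  (\int[mu]_(x in A) (p (psi x) * dpsi x)%:E)%E.
have nu0 : nu set0 = 0%E by rewrite /nu integral_set0.
have nu_ge0 A : (0 <= nu A)%E by apply: integral_ge0 => x _; rewrite lee_fin.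
have nu_sadd : semi_sigma_additive nu.
  move=> A mA tA mUA; rewrite /nu ge0_integral_bigcup//=.
  - by apply: is_cvg_ereal_nneg_natsum_cond => n _ _; exact: nu_ge0.
  - exact/measurable_funTS/measurable_EFinP.
  - by move=> x _; rewrite lee_fin.
pose nuM := isMeasure.Build _ _ _ nu nu0 nu_ge0 nu_sadd.
pose nu' : {measure set (measurableTypeR R) -> \bar R} := HB.pack nu nuM.
have itvE (a b : R) : a < b -> law X `]a, b] = nu' `]a, b].
  move=> ab.
  have -> : law X `]a, b] = law Y `]psi a, psi b].
    have mpre (Z : {RV P >-> R}) a' b' : measurable (Z @^-1` `]a', b']).
      by rewrite -[X in measurable X]setTI; exact: measurable_to_borel.
    apply: (ae_measure_eq (mpre _ _ _) (mpre _ _ _)).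
    apply: filterS YX => w YX; rewrite /preimage/= YX !in_itv/=.
    by rewrite !(leW_mono (le_mono psi_incr)) (le_mono psi_incr).
  rewrite /= [LHS]Yp_// /nu.
  have mpI I : measurable_fun I (EFin \o p).
    exact/measurable_funTS/measurable_EFinP.
  have mfI I : measurable_fun I (fun x => (p (psi x) * dpsi x)%:E).
    exact/measurable_funTS/measurable_EFinP.
  rewrite integral_itv_obnd_cbnd// [RHS]integral_itv_obnd_cbnd//.
  rewrite integration_by_substitution_increasing ?(ltW ab)//.
  - by apply: eq_integral => x _; rewrite psiE.
  - by move=> x y _ _; exact: psi_incr.
  - by move=> x _; rewrite psiE; exact: cdpsi.
  - rewrite psiE; apply/cvg_ex; exists (dpsi a).
    by apply: cvg_at_right_filter; exact: cdpsi.
  - rewrite psiE; apply/cvg_ex; exists (dpsi b).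
    by apply: cvg_at_left_filter; exact: cdpsi.
  - split => //.
    + by apply: cvg_at_right_filter; exact: cpsi.
    + by apply: cvg_at_left_filter; exact: cpsi.
  - exact: continuous_subspaceT.
move=> A mA; rewrite -[LHS]/(law X A) -[RHS]/(nu' A).
apply: (@measure_unique _ R (measurableTypeR R) (@ocitv R)
  (fun k => `](- k%:R), k%:R]%classic) _ _ _ _ (law X) nu') => //.
- exact: ocitvI.
- by move=> k; exact: is_ocitv.
- rewrite -subTset => x _; exists (Num.truncn `|x|).+1 => //=.
  have := truncnS_gt `|x|; rewrite ltr_norml => /andP[? /ltW ?].
  by rewrite in_itv/=; apply/andP.
- move=> _ [[a b] _ <-]/=.
  have [ab|ba] := ltP a b; first exact: itvE.
  by rewrite set_itv_ge ?bnd_simp -?leNgt// !measure0.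
- by move=> k; rewrite (le_lt_trans (probability_le1 _ _)) ?ltry.
Qed.
End density.

(** * Calculus with the normal density *)

Section gaussian_calculus.
Context (R : realType).
Implicit Types (F f g G : R -> R) (m s x y : R).

Local Notation mu := (@lebesgue_measure R).

(** The integral of [g] over [`[- n, n]] is [G n - G (- n)], which vanishes in
    the limit. *)
Lemma integral_derive_vanishing G g :
  (forall x, is_derive x (1 : R) G (g x)) -> continuous g ->
  mu.-integrable setT (EFin \o g) ->
  G n%:R @[n --> \oo] --> 0 -> G (- n%:R) @[n --> \oo] --> 0 ->
  \int[mu]_x g x = 0.
Proof.
move=> dG cg ig Gy GNy.
(* [n.+1] rather than [n] keeps the interval nondegenerate for [n = 0]. *)
pose D n : set R := `[- n.+1%:R, n.+1%:R].
have mD n : measurable (D n) by exact: measurable_itv.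
have mg : measurable_fun setT (EFin \o g).
  by apply/measurable_EFinP; exact: continuous_measurable_fun.
have cG : continuous G by exact: is_derive_continuous dG.
have DE n : (\int[mu]_x ((EFin \o g) \_ (D n)) x =
    (G n.+1%:R - G (- n.+1%:R))%:E)%E.
  rewrite -integral_mkcond EFinB (@continuous_FTC2 _ g G)//.
  - by rewrite gtrN.
  - exact: continuous_subspaceT.
  - split => //.
    + by apply: cvg_at_right_filter; exact: cG.
    + by apply: cvg_at_left_filter; exact: cG.
  - by move=> x _; rewrite derive1E derive_val.
have cvg0 : (G n.+1%:R - G (- n.+1%:R)) @[n --> \oo] --> (0 : R).
  rewrite -[0]subr0; apply: cvgB.
    by move: Gy; rewrite -(cvg_shiftS (fun n => G n%:R)).
  by move: GNy; rewrite -(cvg_shiftS (fun n => G (- n%:R))).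
have [|||||_ _] := @dominated_convergence _ _ _ mu _ measurableT
  (fun n => (EFin \o g) \_ (D n)) (EFin \o g) (fun x => `|(g x)%:E|)%E.
- move=> n; apply: (measurable_restrictT (EFin \o g) (mD n)).1.
  exact: measurable_funS mg.
- by [].
- apply: aeW => x _; apply: cvg_near_cst.
  exists (Num.truncn `|x|) => // n /= xn.
  rewrite patchE mem_set// /D/= in_itv/= -ler_norml.
  by rewrite (le_trans (ltW (truncnS_gt _)))// ler_nat.
- exact: integrable_abse.
- apply: aeW => x n _; rewrite patchE; case: ifPn => // _.
  by rewrite abse0.
rewrite (_ : (fun n => _) = (fun n => (G n.+1%:R - G (- n.+1%:R))%:E));
    last first.
  by apply/funext => n; exact: DE.
move=> intg; rewrite /Rintegral.
suff -> : (\int[mu]_x (g x)%:E)%E = 0%:E by [].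
apply: (cvg_unique _ intg) => //.
by apply: cvg_EFin => //; exact: nearW.
Qed.

Definition exp_bounded F := exists C K : R,
  0 <= K /\ forall y, `|F y| <= C * expR (K * `|y|).

Lemma exp_bounded_le F G :
  (forall y, `|F y| <= `|G y|) -> exp_bounded G -> exp_bounded F.
Proof.
move=> FG [C [K [K0 GC]]]; exists C, K; split => // y.
exact: le_trans (FG y) (GC y).
Qed.

Lemma exp_bounded_bounded F M : (forall y, `|F y| <= M) -> exp_bounded F.
Proof.
by move=> FM; exists M, 0; split => // y; rewrite mul0r expR0 mulr1.
Qed.

Lemma exp_bounded_cst c : exp_bounded (cst c).
Proof. by apply: (@exp_bounded_bounded _ `|c|). Qed.

Lemma exp_bounded_id : exp_bounded id.
Proof.
exists 1, 1; split => // y; rewrite !mul1r.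
by rewrite (le_trans _ (expR_ge1Dx _))// lerDr.
Qed.

Lemma exp_boundedM F G :
  exp_bounded F -> exp_bounded G -> exp_bounded (fun y => F y * G y).
Proof.
move=> [C [K [K0 FC]]] [D [L [L0 GD]]]; exists (C * D), (K + L).
split; first exact: addr_ge0.
move=> y; rewrite normrM mulrDl expRD mulrACA.
by apply: ler_pM.
Qed.

Lemma exp_boundedD F G :
  exp_bounded F -> exp_bounded G -> exp_bounded (fun y => F y + G y).
Proof.
move=> [C [K [K0 FC]]] [D [L [L0 GD]]]; exists (C + D), (K + L).
have C0 : 0 <= C.
  by have := le_trans (normr_ge0 _) (FC 0); rewrite normr0 mulr0 expR0 mulr1.
have D0 : 0 <= D.
  by have := le_trans (normr_ge0 _) (GD 0); rewrite normr0 mulr0 expR0 mulr1.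
split; first exact: addr_ge0.
move=> y; rewrite mulrDl (le_trans (ler_normD _ _))// lerD//.
  rewrite (le_trans (FC y))// ler_wpM2l// ler_expR ler_wpM2r//.
  by rewrite lerDl.
rewrite (le_trans (GD y))// ler_wpM2l// ler_expR ler_wpM2r//.
by rewrite lerDr.
Qed.

(** The moment generating function of the normal law. *)
Definition normal_mgf m s k := expR (k * m + k ^+ 2 * s ^+ 2 / 2).

(** Completing the square: an exponential weight only translates the density.
    This is how every function of exponential growth is brought back to the
    known integral of a normal density. *)
Lemma exp_tilt_normal m s k y : s != 0 ->
  expR (k * y) * normal_pdf m s y =
  normal_mgf m s k * normal_pdf (m + k * s ^+ 2) s y.
Proof.
move=> s0; rewrite !normal_pdfE// mulrCA [RHS]mulrCA -!expRD.
congr (_ * expR _).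
by field.
Qed.

Lemma exp_abs_normal_le m s K y : s != 0 ->
  expR (K * `|y|) * normal_pdf m s y <=
  normal_mgf m s K * normal_pdf (m + K * s ^+ 2) s y +
  normal_mgf m s (- K) * normal_pdf (m + - K * s ^+ 2) s y.
Proof.
move=> s0; rewrite -(exp_tilt_normal m K y s0) -(exp_tilt_normal m (- K) y s0).
rewrite -mulrDl ler_wpM2r ?normal_pdf_ge0//.
have [y0|y0] := leP 0 y.
  by rewrite ger0_norm// lerDl expR_ge0.
by rewrite ltr0_norm// mulrN mulNr lerDr expR_ge0.
Qed.

Lemma integrable_normal m s F : s != 0 -> measurable_fun setT F ->
  exp_bounded F -> mu.-integrable setT (fun y => (F y * normal_pdf m s y)%:E).
Proof.
move=> s0 mF [C [K [K0 FC]]].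
have C0 : 0 <= C.
  by have := le_trans (normr_ge0 _) (FC 0); rewrite normr0 mulr0 expR0 mulr1.
apply: (@le_integrable _ _ _ mu _ measurableT _ (fun y =>
   C%:E * ((normal_mgf m s K)%:E * (normal_pdf (m + K * s ^+ 2) s y)%:E +
    (normal_mgf m s (- K))%:E * (normal_pdf (m + - K * s ^+ 2) s y)%:E))%E).
- apply/measurable_EFinP; apply: measurable_funM => //.
  exact: measurable_normal_pdf.
- move=> y _; rewrite /= lee_fin normrM.
  rewrite (ger0_norm (normal_pdf_ge0 _ _ _)).
  rewrite (le_trans _ (ler_norm _))//.
  rewrite (le_trans (ler_wpM2r (normal_pdf_ge0 _ _ _) (FC y)))//.
  by rewrite -mulrA ler_wpM2l// exp_abs_normal_le.
- apply: integrableZl => //; apply: integrableD => //;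
  apply: integrableZl => //; exact: integrable_normal_pdf.
Qed.

(** The growth of [F] is absorbed with one spare factor [expR `|y|], so that the
    product still vanishes at infinity. *)
Lemma exp_bounded_normal_le m s F : s != 0 -> exp_bounded F ->
  exists D, forall y, `|F y * normal_pdf m s y| <= D * expR (- `|y|).
Proof.
move=> s0 [C [K [K0 FC]]].
have C0 : 0 <= C.
  by have := le_trans (normr_ge0 _) (FC 0); rewrite normr0 mulr0 expR0 mulr1.
(* The spare unit of growth in [L] leaves the factor [expR (- `|y|)]. *)
pose L := K + 1.
pose S := normal_mgf m s L + normal_mgf m s (- L).
exists (C * (S * normal_peak s)) => y.
rewrite normrM (ger0_norm (normal_pdf_ge0 _ _ _)).
rewrite (le_trans (ler_wpM2r (normal_pdf_ge0 _ _ _) (FC y)))//.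
have -> : expR (K * `|y|) = expR (L * `|y|) * expR (- `|y|).
  by rewrite -expRD; congr expR; rewrite /L; ring.
have -> : C * (expR (L * `|y|) * expR (- `|y|)) * normal_pdf m s y =
    C * (expR (L * `|y|) * normal_pdf m s y) * expR (- `|y|) by ring.
rewrite ler_wpM2r ?expR_ge0// ler_wpM2l//.
apply: (le_trans (exp_abs_normal_le _ _ _ s0)).
rewrite [leRHS]mulrDl; apply: lerD; apply: ler_wpM2l;
  by rewrite ?expR_ge0// normal_pdf_ub.
Qed.

Lemma is_derive_normal_pdf m s y : s != 0 ->
  is_derive y (1 : R) (normal_pdf m s)
    (- ((y - m) / s ^+ 2) * normal_pdf m s y).
Proof.
move=> s0; rewrite normal_pdfE//.
have dq : is_derive y (1 : R) (fun y => - (y - m) ^+ 2 / (s ^+ 2 *+ 2))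
    (- ((y - m) / s ^+ 2)).
  apply: is_derive_eq.
  by rewrite /GRing.scale/=; field.
have dexp := @is_derive1_comp R expR _ y _ _ (is_derive_expR _) dq.
have := is_deriveZ (normal_peak s) dexp.
move=> /is_derive_eq; apply.
by rewrite /GRing.scale/= /normal_fun; ring.
Qed.

Lemma cvg_expRN_nat : expR (- n%:R) @[n --> \oo] --> (0 : R).
Proof.
apply: (cvg_comp (fun n => n%:R : R) (fun x => expR (- x))).
  exact: cvgr_idn.
exact: cvgr_expR.
Qed.

(** Gaussian integration by parts: [(F p)' = f p - s ^- 2 (y - m) F p], and the
    integral of the left-hand side is zero as [F p] vanishes at infinity. *)
Lemma stein_normal m s F f : s != 0 ->
  (forall y, is_derive y (1 : R) F (f y)) -> continuous f ->
  exp_bounded F -> exp_bounded f ->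
  \int[mu]_y (f y * normal_pdf m s y) * s ^+ 2 =
  \int[mu]_y ((y - m) * F y * normal_pdf m s y).
Proof.
move=> s0 dF cf bF bf.
have cF : continuous F by exact: is_derive_continuous dF.
have cym : continuous (fun y : R => y - m).
  by move=> y; apply: cvgB; [exact: cvg_id|exact: cvg_cst].
have bym : exp_bounded (fun y => y - m).
  apply: exp_boundedD; first exact: exp_bounded_id.
  exact: exp_bounded_cst.
have i1 : mu.-integrable setT (EFin \o (fun y => f y * normal_pdf m s y)).
  by apply: integrable_normal => //; exact: continuous_measurable_fun.
have i2 : mu.-integrable setT
    (EFin \o (fun y => (y - m) * F y * normal_pdf m s y)).
  apply: (@integrable_normal m s (fun y => (y - m) * F y)) => //.
    by apply: measurable_funM; exact: continuous_measurable_fun.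
  exact: exp_boundedM.
have [D FD] := exp_bounded_normal_le m s0 bF.
have cvgF (u : nat -> R) : (forall n, `|u n| = n%:R) ->
    F (u n) * normal_pdf m s (u n) @[n --> \oo] --> (0 : R).
  move=> un; apply: norm_cvg0.
  have cvgD : D * expR (- n%:R) @[n --> \oo] --> (0 : R).
    rewrite -[0](mulr0 D); apply: cvgM; first exact: cvg_cst.
    exact: cvg_expRN_nat.
  apply: (squeeze_cvgr _ (cvg_cst 0) cvgD).
  by apply: nearW => n; rewrite normr_ge0/= -un FD.
have i3 : mu.-integrable setT
    (EFin \o (fun y => s ^- 2 * ((y - m) * F y * normal_pdf m s y))).
  exact: (integrableZl measurableT (s ^- 2) i2).
have : \int[mu]_y (f y * normal_pdf m s y -
    s ^- 2 * ((y - m) * F y * normal_pdf m s y)) = 0.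
  apply: (@integral_derive_vanishing (fun y => F y * normal_pdf m s y)).
  - move=> y; apply: is_derive_eq.
      exact: is_deriveM (is_derive_normal_pdf m y s0).
    by rewrite /GRing.scale/=; field.
  - move=> y; have cp := @continuous_normal_pdf R m s s0.
    apply: cvgB; first by apply: cvgM; [exact: cf|exact: cp].
    apply: cvgM; first exact: cvg_cst.
    apply: cvgM; last exact: cp.
    by apply: cvgM; [exact: cym|exact: cF].
  - rewrite /comp; under eq_fun do rewrite EFinB.
    exact: integrableB.
  - by apply: cvgF => n; rewrite ger0_norm.
  - by apply: cvgF => n; rewrite normrN ger0_norm.
rewrite RintegralB// RintegralZl// => /subr0_eq ->.
by rewrite mulrAC mulVf ?mul1r// sqrf_eq0.
Qed.

End gaussian_calculus.

(** * Gaussian random variables and fractional Brownian motion *)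

Section gaussian_random_variable.
Context d (T : measurableType d) (R : realType) (P : probability T R).
Implicit Types (Y : {RV P >-> R}) (F f : R -> R) (m s : R).

Local Notation mu := (@lebesgue_measure R).

Lemma scale_rvE (c : R) Y w : (c *: Y : {RV P >-> R}) w = c * Y w.
Proof. by []. Qed.

Lemma gaussian_integrable Y m s F : s != 0 -> has_density Y (normal_pdf m s) ->
  measurable_fun setT F -> exp_bounded F ->
  P.-integrable setT (EFin \o (fun w => F (Y w))).
Proof.
move=> s0 Ys mF bF; apply: (integrable_density Ys mF).
exact: integrable_normal.
Qed.

(** Integration by parts also yields the mean ([F = 1]), the variance
    ([F y = y - m]) and, later, the cross term of the Fisher information. *)
Lemma gaussian_stein Y m s F f : s != 0 -> has_density Y (normal_pdf m s) ->
  (forall y, is_derive y (1 : R) F (f y)) -> continuous f ->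
  exp_bounded F -> exp_bounded f ->
  \int[P]_w f (Y w) * s ^+ 2 = \int[P]_w ((Y w - m) * F (Y w)).
Proof.
move=> s0 Ys dF cf bF bf.
have cF : continuous F by exact: is_derive_continuous dF.
have mf := continuous_measurable_fun cf.
have mF : measurable_fun setT (fun y : R => (y - m) * F y).
  apply: measurable_funM; first exact: measurable_funB.
  exact: continuous_measurable_fun.
have bym : exp_bounded (fun y => y - m).
  apply: exp_boundedD; first exact: exp_bounded_id.
  exact: exp_bounded_cst.
rewrite (integral_density Ys mf (integrable_normal _ s0 mf bf)).
rewrite (integral_density (F := fun y => (y - m) * F y) Ys mF); last first.
  by apply: integrable_normal => //; exact: exp_boundedM.
exact: stein_normal.
Qed.

Lemma gaussian_mean Y m s : s != 0 -> has_density Y (normal_pdf m s) ->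
  \int[P]_w Y w = m.
Proof.
move=> s0 Ys.
have := gaussian_stein s0 Ys (fun y => is_derive_cst (1 : R) y 1)
  (@cst_continuous _ _ 0) (exp_bounded_cst 1) (exp_bounded_cst 0).
rewrite Rintegral_cst// mul0r.
under eq_Rintegral do rewrite mulr1.
have iY : P.-integrable setT (EFin \o Y).
  exact: (@gaussian_integrable Y m s id s0 Ys _ (@exp_bounded_id R)).
rewrite RintegralB//; last exact: finite_measure_integrable_cst.
rewrite Rintegral_cst//= probability_setT/= mulr1 mul0r.
by move=> /esym/subr0_eq.
Qed.

Lemma gaussian_variance Y m s : s != 0 -> has_density Y (normal_pdf m s) ->
  \int[P]_w (Y w - m) ^+ 2 = s ^+ 2.
Proof.
move=> s0 Ys.
have bym : exp_bounded (fun y => y - m).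
  apply: exp_boundedD; first exact: exp_bounded_id.
  exact: exp_bounded_cst.
have dym y : is_derive y (1 : R) (fun y => y - m) (cst 1 y).
  by apply: is_derive_eq; rewrite subr0.
have c1 : continuous (cst 1 : R -> R) by move=> y; exact: cvg_cst.
have := gaussian_stein s0 Ys dym c1 bym (exp_bounded_cst 1).
by rewrite Rintegral_cst//= probability_setT/= !mul1r => ->.
Qed.

Lemma normal_pdf_sqr m s s' : s != 0 -> s ^+ 2 = s' ^+ 2 ->
  normal_pdf m s = normal_pdf m s'.
Proof.
move=> s0 ss'.
have s'0 : s' != 0 by rewrite -sqrf_eq0 -ss' sqrf_eq0.
apply/funext => y.
by rewrite !normal_pdfE// /normal_peak /normal_fun ss'.
Qed.

(** The parameters of a normal law are its first two moments, and a Dirac mass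
    is excluded by the positive second moment. *)
Lemma gaussian_law_centered Y s : s != 0 -> gaussian_law (distribution P Y) ->
  ('E_P[Y] = 0)%E -> ('E_P[fun w => (Y w * Y w)%R] = (s ^+ 2)%:E)%E ->
  has_density Y (normal_pdf 0 s).
Proof.
move=> s0 [[m [s' [s'0 Yms]]]|[c Yc]] EY EY2.
  have Ys' : has_density Y (normal_pdf m s').
    split; [exact: measurable_normal_pdf|exact: normal_pdf_ge0|exact: Yms].
  have m0 : m = 0.
    rewrite -(gaussian_mean s'0 Ys') /Rintegral.
    by move: EY; rewrite unlock => ->.
  rewrite (_ : normal_pdf 0 s = normal_pdf m s')//.
  rewrite m0; apply: normal_pdf_sqr => //.
  rewrite -(gaussian_variance s'0 Ys') m0 /Rintegral.
  move: EY2; rewrite unlock => EY2.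
  under eq_integral do rewrite subr0 expr2.
  by rewrite EY2.
have {}Yc : {ae P, forall w, Y w = c}.
  have mc : measurable (~` [set c] : set R) by exact: measurableC.
  exists (Y @^-1` (~` [set c])); split => //.
    by rewrite -[X in measurable X]setTI; exact: measurable_funPT.
  by rewrite [LHS](Yc _ mc) /dirac indicE memNset//= => /(_ erefl).
have c0 : c = 0.
  apply: EFin_inj; rewrite -[RHS]EY unlock.
  rewrite (ae_eq_integral (cst c%:E))//; last 2 first.
  - exact/measurable_EFinP.
  - by apply: filterS Yc => w -> _.
  by rewrite integral_cst//= probability_setT mule1.
move: EY2; rewrite unlock (ae_eq_integral (cst 0%:E))//; last 2 first.
- by apply/measurable_EFinP; exact: measurable_funM.
- by apply: filterS Yc => w -> _; rewrite c0 mul0r.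
rewrite integral_cst//= mul0e => -[] /esym/eqP.
by rewrite sqrf_eq0 (negbTE s0).
Qed.

End gaussian_random_variable.

Section fbm.
Context d (T : measurableType d) (R : realType) (P : probability T R).
Variables (H : R) (B : R -> {RV P >-> R}).
Hypothesis H0 : 0 < H.
Hypothesis fbmB : fractional_brownian_motion H B.

Lemma sqr_powR (t : R) : (t `^ H) ^+ 2 = t `^ (2 * H).
Proof. by rewrite mulrC powRrM powR_mulrn ?powR_ge0. Qed.

Lemma fbm_scale_gaussian (c t : R) : 0 <= t ->
  gaussian_law (distribution P (c *: B t : {RV P >-> R})).
Proof.
move=> t0; have [gB _ _ _] := fbmB.
have := gB 1%N (fun=> t) (fun=> c) (fun=> t0).
rewrite (_ : (fun w => _) = (c *: B t : {RV P >-> R}))//.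
by apply/funext => w; rewrite big_ord1.
Qed.

Lemma fbm_density (t : R) : 0 < t -> has_density (B t) (normal_pdf 0 (t `^ H)).
Proof.
move=> t0; have [_ cB _ covB] := fbmB.
apply: gaussian_law_centered.
- by rewrite gt_eqF// powR_gt0.
- have := fbm_scale_gaussian 1 (ltW t0).
  by rewrite (_ : distribution _ _ = distribution P (B t))// scale1r.
- by apply: cB; exact: ltW.
- rewrite covB ?ltW// subrr normr0 powR0 ?gt_eqF ?mulr_gt0//.
  by rewrite sqr_powR subr0; congr EFin; field.
Qed.

(** Since all multiples [c *: B t] are covered, this replaces a scaling lemma
    for the normal density; [c = -1] gives the symmetry of the law, and
    [c = (r / t) `^ H] the law of [B r]. *)
Lemma fbm_scale_density (c t : R) : c != 0 -> 0 < t ->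
  has_density (c *: B t : {RV P >-> R}) (normal_pdf 0 (`|c| * t `^ H)).
Proof.
move=> c0 t0; have [_ cB _ covB] := fbmB.
have tH0 : t `^ H != 0 by rewrite gt_eqF// powR_gt0.
have Bt := fbm_density t0.
have iB : P.-integrable setT (EFin \o B t).
  exact: (gaussian_integrable tH0 Bt _ (@exp_bounded_id R)).
have iB2 : P.-integrable setT (EFin \o (fun w => B t w * B t w)).
  apply: (@gaussian_integrable _ _ _ _ _ _ _ (fun y => y * y) tH0 Bt) => //.
  - exact: measurable_funM.
  - exact: exp_boundedM (@exp_bounded_id R) (@exp_bounded_id R).
apply: gaussian_law_centered.
- by rewrite mulf_neq0// normr_eq0.
- exact: fbm_scale_gaussian (ltW t0).
- rewrite unlock; under eq_integral do rewrite /= EFinM.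
  by have := cB t (ltW t0); rewrite unlock integralZl// => ->; rewrite mule0.
- rewrite unlock.
  transitivity (\int[P]_w ((c ^+ 2)%:E * (B t w * B t w)%:E))%E.
    apply: eq_integral => w _; rewrite -EFinM; congr EFin.
    by rewrite scale_rvE; ring.
  rewrite integralZl//.
  have := covB t t (ltW t0) (ltW t0); rewrite unlock => ->.
  rewrite subrr normr0 powR0 ?gt_eqF ?mulr_gt0//.
  rewrite -EFinM; congr EFin; rewrite exprMn real_normK ?num_real// sqr_powR.
  by field.
Qed.

End fbm.

(** * The flow of the differential equation *)

Section flow.
Context (R : realType).
Implicit Types (sigma phi : R -> R) (x y : R).

Lemma flow_continuous sigma phi :
  (forall y, is_derive y (1 : R) phi (sigma (phi y))) -> continuous phi.
Proof. exact: is_derive_continuous. Qed.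

Lemma flow_increasing sigma phi : (forall x, 0 < sigma x) ->
  (forall y, is_derive y (1 : R) phi (sigma (phi y))) ->
  {homo phi : x y / x < y}.
Proof.
move=> s0 dphi x y xy; rewrite -subr_gt0.
have [|c _ ->] := MVT xy (fun z _ => dphi z).
  exact/continuous_subspaceT/(flow_continuous dphi).
by rewrite mulr_gt0// subr_gt0.
Qed.

(** If the flow stayed below [x], then it would move inside [`[phi 0, x]], where
    its speed is at least the minimum of [sigma]; it would leave this interval
    in finite time. *)
Lemma flow_reaches sigma phi x : (forall x, 0 < sigma x) -> continuous sigma ->
  (forall y, is_derive y (1 : R) phi (sigma (phi y))) ->
  phi 0 <= x -> exists y, phi y = x.
Proof.
move=> s0 cs dphi x0; apply: contrapT => nx.
have cphi := flow_continuous dphi.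
have phi_lt y : 0 <= y -> phi y < x.
  move=> y0; rewrite ltNge; apply/negP => xy; apply: nx.
  have [|c _ cx] := @IVT _ phi 0 y x y0 (continuous_subspaceT cphi).
    by rewrite min_l ?max_r ?x0 ?xy ?(le_trans x0).
  by exists c.
have [z _ zmin] := EVT_min x0 (continuous_subspaceT cs).
(* At the minimal speed [sigma z], the level [x] is crossed before time [y]. *)
pose y := (x - phi 0) / sigma z + 1.
have y0 : 0 < y by rewrite ltr_wpDl// divr_ge0 ?subr_ge0// ltW.
have [|c + phiy] := MVT y0 (fun z _ => dphi z).
  exact: continuous_subspaceT.
rewrite in_itv/= => /andP[c0 cy].
have zc : sigma z <= sigma (phi c).
  apply: zmin; rewrite in_itv/= !ltW ?phi_lt ?(ltW c0)//.
  exact: (flow_increasing s0 dphi).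
have := phi_lt y (ltW y0); apply/negP; rewrite -leNgt.
rewrite -(lerD2r (- phi 0)) phiy subr0.
rewrite (le_trans _ (ler_wpM2r (ltW y0) zc))// /y mulrDr mulr1.
rewrite mulrCA divff ?gt_eqF//.
by rewrite mulr1 lerDl ltW.
Qed.

(** Points below [phi 0] are reached backwards in time: [- phi (- y)] is a flow
    of the reflected field [sigma (- x)]. *)
Lemma flow_surjective sigma phi x :
  (forall x, 0 < sigma x) -> continuous sigma ->
  (forall y, is_derive y (1 : R) phi (sigma (phi y))) -> exists y, phi y = x.
Proof.
move=> s0 cs dphi; have [x0|x0] := leP (phi 0) x.
  exact: flow_reaches dphi x0.
have := @flow_reaches (fun x => sigma (- x)) (fun y => - phi (- y)) (- x).
case.
- by move=> y; exact: s0.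
- move=> y; apply: continuous_comp; [exact: opp_continuous|exact: cs].
- move=> y; have := @is_derive1_comp _ phi -%R y _ _ (dphi _) (is_deriveNid _ _).
  move=> /is_deriveN /is_derive_eq; apply.
  by rewrite opprK mulrN1 opprK.
- by rewrite oppr0 lerN2 ltW.
- by move=> y /oppr_inj <-; exists (- y).
Qed.

Lemma flow_inverse sigma phi : (forall x, 0 < sigma x) -> continuous sigma ->
  (forall y, is_derive y (1 : R) phi (sigma (phi y))) ->
  exists psi, [/\ cancel phi psi, cancel psi phi,
    {homo psi : x y / x < y} &
    forall x, is_derive x (1 : R) psi (sigma x)^-1].
Proof.
move=> s0 cs dphi; have phi_incr := flow_increasing s0 dphi.
pose psi x := sval (cid (flow_surjective x s0 cs dphi)).
have psiK : cancel psi phi by move=> x; rewrite /psi; case: cid.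
have phi_inj : injective phi.
  by apply: inc_inj; exact: le_mono.
have phiK : cancel phi psi by move=> y; apply: phi_inj; rewrite psiK.
exists psi; split => //.
  by move=> x y; rewrite -{1}(psiK x) -{1}(psiK y) (leW_mono (le_mono phi_incr)).
move=> x; rewrite -{1 2}(psiK x).
apply: (@is_derive_inverse _ phi psi) => //.
- by near=> y; exact: phiK.
- by near=> y; exact: flow_continuous dphi y.
- by rewrite gt_eqF.
Unshelve. all: by end_near. Qed.

(** Along the flow, [(ln sigma)' = sigma' / sigma * sigma = sigma']. *)
Lemma is_derive_ln_flow sigma sigma1 phi : (forall x, 0 < sigma x) ->
  (forall x, is_derive x (1 : R) sigma (sigma1 x)) ->
  (forall y, is_derive y (1 : R) phi (sigma (phi y))) ->
  forall y, is_derive y (1 : R) (fun y => ln (sigma (phi y))) (sigma1 (phi y)).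
Proof.
move=> s0 ds dphi y.
have d1 := @is_derive1_comp _ sigma phi y _ _ (ds _) (dphi y).
have d2 := @is_derive1_comp _ (@ln R) (sigma \o phi) y _ _
  (is_derive1_ln (s0 _)) d1.
by apply: (is_derive_eq d2) => /=; rewrite mulrCA mulVf ?mulr1// gt_eqF.
Qed.

Lemma lipschitz_growth (g g1 : R -> R) (M : R) :
  (forall y, is_derive y (1 : R) g (g1 y)) -> (forall y, `|g1 y| <= M) ->
  forall y, `|g y| <= `|g 0| + M * `|y|.
Proof.
move=> dg gM y; rewrite -lerBlDl (le_trans (lerB_dist _ _))//.
have cg : continuous g by exact: is_derive_continuous dg.
have [y0|y0|<-] := ltgtP 0 y; last by rewrite subrr !normr0 mulr0.
- have [|c _ ->] := MVT y0 (fun z _ => dg z); first exact: continuous_subspaceT.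
  by rewrite subr0 normrM ler_wpM2r.
- have [|c _] := MVT y0 (fun z _ => dg z); first exact: continuous_subspaceT.
  by rewrite distrC sub0r => ->; rewrite normrM normrN ler_wpM2r.
Qed.

Lemma lipschitz_exp_bounded (g g1 : R -> R) (M : R) :
  (forall y, is_derive y (1 : R) g (g1 y)) -> (forall y, `|g1 y| <= M) ->
  exp_bounded g.
Proof.
move=> dg gM; have M0 := le_trans (normr_ge0 _) (gM 0).
apply: (@exp_bounded_le _ _ (fun y => `|g 0| + M * `|y|)).
  move=> y; rewrite [leRHS]ger0_norm ?addr_ge0 ?mulr_ge0//.
  exact: (lipschitz_growth dg gM).
apply: exp_boundedD; first exact: exp_bounded_cst.
apply: exp_boundedM; first exact: exp_bounded_cst.
by apply: exp_bounded_le (@exp_bounded_id R) => y; rewrite normr_id.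
Qed.

(** [ln (sigma (phi y))] is Lipschitz because [sigma'] is bounded. *)
Lemma exp_bounded_flow sigma sigma1 phi M : (forall x, 0 < sigma x) ->
  (forall x, is_derive x (1 : R) sigma (sigma1 x)) ->
  (forall x, `|sigma1 x| <= M) ->
  (forall y, is_derive y (1 : R) phi (sigma (phi y))) ->
  exp_bounded (fun y => sigma (phi y)).
Proof.
move=> s0 ds sM dphi; have dln := is_derive_ln_flow s0 ds dphi.
have M0 := le_trans (normr_ge0 _) (sM 0).
exists (expR `|ln (sigma (phi 0))|), M; split=> // y.
rewrite gtr0_norm// -[leLHS]lnK ?posrE// -expRD ler_expR.
rewrite (le_trans (ler_norm _))//.
exact: (lipschitz_growth dln).
Qed.

Lemma exp_bounded_scale (F : R -> R) c :
  exp_bounded F -> exp_bounded (fun y => F (c * y)).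
Proof.
move=> [C [K [K0 FC]]]; exists C, (K * `|c|); split; first exact: mulr_ge0.
by move=> y; rewrite -mulrA -normrM.
Qed.

End flow.

(** * The entropy derivative for a positive coefficient *)

(** [W] stands for the driving process after the change of sign. *)
Section core.
Context d (T : measurableType d) (R : realType) (P : probability T R).
Variables (H : R) (W X : R -> {RV P >-> R}).
Variables (sigma sigma1 sigma2 phi psi : R -> R) (M : R).
Hypothesis W_density : forall t : R, 0 < t ->
  has_density (W t) (normal_pdf 0 (t `^ H)).
Hypothesis W_scale : forall c t : R, c != 0 -> 0 < t ->
  has_density (c *: W t : {RV P >-> R}) (normal_pdf 0 (`|c| * t `^ H)).
Hypothesis XW : forall t : R, 0 < t -> {ae P, forall w, X t w = phi (W t w)}.
Hypothesis sigma_gt0 : forall x, 0 < sigma x.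
Hypothesis dsigma : forall x, is_derive x (1 : R) sigma (sigma1 x).
Hypothesis dsigma1 : forall x, is_derive x (1 : R) sigma1 (sigma2 x).
Hypothesis csigma2 : continuous sigma2.
Hypothesis sigma1M : forall x, `|sigma1 x| <= M.
Hypothesis sigma2M : forall x, `|sigma2 x| <= M.
Hypothesis dphi : forall y, is_derive y (1 : R) phi (sigma (phi y)).
Hypothesis phiK : cancel phi psi.
Hypothesis psiK : cancel psi phi.
Hypothesis psi_incr : {homo psi : x y / x < y}.
Hypothesis dpsi : forall x, is_derive x (1 : R) psi (sigma x)^-1.

Let csigma : continuous sigma.
Proof. exact: is_derive_continuous dsigma. Qed.
Let csigma1 : continuous sigma1.
Proof. exact: is_derive_continuous dsigma1. Qed.
Let cpsi : continuous psi.
Proof. exact: is_derive_continuous dpsi. Qed.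
Let cphi : continuous phi := flow_continuous dphi.
Let cphi_comp (g : R -> R) : continuous g -> continuous (g \o phi).
Proof. by move=> cg y; apply: continuous_comp; [exact: cphi|exact: cg]. Qed.

Let tH_neq0 (t : R) : 0 < t -> t `^ H != 0.
Proof. by move=> t0; rewrite gt_eqF// powR_gt0. Qed.

Let G y := ln (sigma (phi y)).
Let dG y : is_derive y (1 : R) G (sigma1 (phi y)).
Proof. exact: (is_derive_ln_flow sigma_gt0 dsigma dphi). Qed.
Let cG : continuous G.
Proof. exact: is_derive_continuous dG. Qed.
Let bG : exp_bounded G.
Proof. by apply: (lipschitz_exp_bounded (M := M) dG) => y; exact: sigma1M. Qed.
Let bs1 : exp_bounded (sigma1 \o phi).
Proof. by apply: (@exp_bounded_bounded _ _ M) => y; exact: sigma1M. Qed.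
Let bs2s : exp_bounded (fun y => sigma2 (phi y) * sigma (phi y)).
Proof.
apply: exp_boundedM; last exact: exp_bounded_flow sigma_gt0 dsigma sigma1M dphi.
by apply: (@exp_bounded_bounded _ _ M) => y; exact: sigma2M.
Qed.
Let cs2s : continuous (fun y => sigma2 (phi y) * sigma (phi y)).
Proof.
by move=> y; apply: cvgM; [exact: (cphi_comp csigma2)|exact: (cphi_comp csigma)].
Qed.
Let ds1 y : is_derive y (1 : R) (sigma1 \o phi) (sigma2 (phi y) * sigma (phi y)).
Proof. exact: (@is_derive1_comp _ sigma1 phi y _ _ (dsigma1 _) (dphi y)). Qed.

Let iW (t : R) K : 0 < t -> continuous K -> exp_bounded K ->
  P.-integrable setT (EFin \o (fun w => K (W t w))).
Proof.
move=> t0 cK bK; apply: gaussian_integrable (W_density t0) _ bK => //.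
- exact: tH_neq0.
- exact: continuous_measurable_fun.
Qed.

(** Every expectation in the formula is that of some [F (X t)] whose pull-back
    [K] by the flow is explicit and grows at most exponentially.  Measurability
    of [F] comes from [F = K \o psi]. *)
Lemma expectation_solution (t : R) (F K : R -> R) : 0 < t ->
  continuous K -> exp_bounded K -> (forall y, F (phi y) = K y) ->
  ('E_P[fun w => F (X t w)] = (\int[P]_w K (W t w))%:E)%E.
Proof.
move=> t0 cK bK FK.
have mK := continuous_measurable_fun cK.
have mF : measurable_fun setT F.
  rewrite (_ : F = K \o psi); last by apply/funext => x; rewrite /= -FK psiK.
  by apply: measurableT_comp => //; exact: continuous_measurable_fun.
rewrite unlock /Rintegral fineK; last first.
  by apply: integrable_fin_num => //; exact: iW.
apply: ae_eq_integral => //.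
- by apply/measurable_EFinP; exact: measurableT_comp.
- by apply/measurable_EFinP; exact: measurableT_comp.
- by apply: filterS (XW t0) => w XWw _; rewrite XWw FK.
Qed.

(** The density is handled as [expR (log_density s x)], which is visibly
    positive and differentiable, and whose logarithm is [log_density] itself. *)
Definition log_density (s x : R) : R :=
  ln (normal_peak s) - psi x ^+ 2 / (s ^+ 2 *+ 2) - ln (sigma x).

Lemma expR_log_density s x : s != 0 ->
  expR (log_density s x) = normal_pdf 0 s (psi x) * (sigma x)^-1.
Proof.
move=> s0; rewrite normal_pdfE// /normal_fun subr0 mulNr.
by rewrite /log_density !expRD !expRN !lnK ?posrE ?normal_peak_gt0.
Qed.

Lemma is_derive_log_density s x : s != 0 ->
  is_derive x (1 : R) (log_density s)
    (- ((psi x / s ^+ 2 + sigma1 x) / sigma x)).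
Proof.
move=> s0.
have dl := @is_derive1_comp _ (@ln R) sigma x _ _
  (is_derive1_ln (sigma_gt0 _)) (dsigma x).
have d2 := is_deriveZ (s ^+ 2 *+ 2)^-1 (is_deriveX 2 (dpsi x)).
have := is_deriveB (is_deriveB (is_derive_cst (ln (normal_peak s)) x 1) d2) dl.
rewrite (_ : _ - _ - _ = log_density s); last first.
  apply/funext => y; rewrite /log_density.
  by rewrite [_ / _]mulrC.
move=> /is_derive_eq; apply.
have sx : sigma x != 0 by rewrite gt_eqF.
by rewrite /GRing.scale/= expr1; field; rewrite sx.
Qed.

Lemma solution_density (t : R) : 0 < t ->
  has_regular_density (X t) (fun x => expR (log_density (t `^ H) x)).
Proof.
move=> t0; have s0 := tH_neq0 t0; split.
  rewrite (_ : (fun x => _) =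
      (fun x => normal_pdf 0 (t `^ H) (psi x) * (sigma x)^-1)).
    apply: (has_density_comp_increasing (W_density t0)) dpsi _ _ => //.
    - exact: continuous_normal_pdf.
    - by apply: filterS (XW t0) => w ->; rewrite phiK.
    - by move=> x; apply: continuousV; [rewrite gt_eqF|exact: csigma].
    - by move=> x; rewrite invr_ge0 ltW.
  by apply/funext => x; exact: expR_log_density.
move=> x; split; first exact: expR_gt0.
have := @is_derive1_comp _ expR (log_density (t `^ H)) x _ _ (is_derive_expR _)
  (is_derive_log_density x s0).
by case.
Qed.

Lemma solution_density_unique (t : R) f : 0 < t -> has_regular_density (X t) f ->
  f = (fun x => expR (log_density (t `^ H) x)).
Proof.
move=> t0 [Xf f0]; have [Xg g0] := solution_density t0.
apply/funext => x; apply: (continuous_density_unique Xf Xg) => y.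
  by apply/differentiable_continuous/derivable1_diffP; exact: (f0 y).2.
by apply/differentiable_continuous/derivable1_diffP; exact: (g0 y).2.
Qed.

Lemma W_second_moment (t : R) : 0 < t -> \int[P]_w (W t w) ^+ 2 = (t `^ H) ^+ 2.
Proof.
move=> t0; rewrite -(gaussian_variance (tH_neq0 t0) (W_density t0)).
by apply: eq_Rintegral => w _; rewrite subr0.
Qed.

(** Integration by parts for [G' = sigma1 \o phi]. *)
Lemma W_stein (t : R) : 0 < t ->
  \int[P]_w (sigma2 (phi (W t w)) * sigma (phi (W t w))) * (t `^ H) ^+ 2 =
  \int[P]_w (W t w * sigma1 (phi (W t w))).
Proof.
move=> t0.
have := gaussian_stein (tH_neq0 t0) (W_density t0) ds1 cs2s bs1 bs2s.
move=> ->; apply: eq_Rintegral => w _.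
by rewrite subr0.
Qed.


Lemma fisher_information_solution (t : R) : 0 < t ->
  fisher_information (fun x => sigma x ^+ 2) (X t)
    (fun x => expR (log_density (t `^ H) x)) =
  ((t `^ H) ^- 2 +
   2 * \int[P]_w (sigma2 (phi (W t w)) * sigma (phi (W t w))) +
   \int[P]_w sigma1 (phi (W t w)) ^+ 2)%:E.
Proof.
move=> t0; have s0 := tH_neq0 t0; set s := t `^ H in s0 *.
rewrite /fisher_information.
pose K y := (s ^- 2 * y + sigma1 (phi y)) ^+ 2.
have cs1 := cphi_comp csigma1.
have cK : continuous K.
  move=> y; apply: cvgM; (apply: cvgD; last exact: cs1);
    by apply: cvgM; [exact: cvg_cst|exact: cvg_id].
have bK : exp_bounded K.
  by apply: exp_boundedM; (apply: exp_boundedD => //; apply: exp_boundedM;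
    [exact: exp_bounded_cst|exact: exp_bounded_id]).
rewrite (expectation_solution
  (F := fun x => sigma x ^+ 2 *
     ((fun x => ln (expR (log_density s x)))^`()%classic x) ^+ 2)
  t0 cK bK); last first.
  move=> y; under [X in derive1 X]eq_fun do rewrite expRK.
  rewrite derive1E (@derive_val _ _ _ _ _ _ _ (is_derive_log_density _ s0)).
  rewrite phiK /K sqrrN.
  by field; rewrite s0 gt_eqF.
congr EFin.
pose A w := s ^- 2 ^+ 2 * (W t w) ^+ 2.
pose C w := (2 * s ^- 2) * (W t w * sigma1 (phi (W t w))).
pose D w := sigma1 (phi (W t w)) ^+ 2.
have iY2 : P.-integrable setT (EFin \o (fun w => (W t w) ^+ 2)).
  apply: (iW (K := fun y => y ^+ 2) t0).
    by move=> y; apply: cvgM; exact: cvg_id.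
  by apply: exp_boundedM; exact: exp_bounded_id.
have iYs : P.-integrable setT (EFin \o (fun w => W t w * sigma1 (phi (W t w)))).
  apply: (iW (K := fun y => y * sigma1 (phi y)) t0).
    by move=> y; apply: cvgM; [exact: cvg_id|exact: cs1].
  by apply: exp_boundedM => //; exact: exp_bounded_id.
have iD : P.-integrable setT (EFin \o D).
  apply: (iW (K := fun y => sigma1 (phi y) ^+ 2) t0).
    by move=> y; apply: cvgM; exact: cs1.
  exact: exp_boundedM.
have iA : P.-integrable setT (EFin \o A).
  exact: (integrableZl measurableT _ iY2).
have iC : P.-integrable setT (EFin \o C).
  exact: (integrableZl measurableT _ iYs).
have iAC : P.-integrable setT (EFin \o (fun w => A w + C w)).
  by rewrite /comp; under eq_fun do rewrite EFinD; exact: integrableD.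
transitivity (\int[P]_w (A w + C w + D w)).
  by apply: eq_Rintegral => w _; rewrite /K /A /C /D; ring.
rewrite RintegralD// RintegralD// RintegralZl// RintegralZl//.
rewrite W_second_moment// -W_stein// -/s.
by congr (_ + _); field.
Qed.

Lemma expectation_quadratic (t a b : R) (F : R -> R) : 0 < t ->
  (forall x, F x = a * (sigma2 x * sigma x) + b * sigma1 x ^+ 2) ->
  ('E_P[fun w => F (X t w)])%E =
  (a * \int[P]_w (sigma2 (phi (W t w)) * sigma (phi (W t w))) +
   b * \int[P]_w sigma1 (phi (W t w)) ^+ 2)%:E.
Proof.
move=> t0 FE.
have cs1 := cphi_comp csigma1.
have csqr : continuous (fun y => sigma1 (phi y) ^+ 2).
  by move=> y; apply: cvgM; exact: cs1.
have bsqr : exp_bounded (fun y => sigma1 (phi y) ^+ 2) by exact: exp_boundedM.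
rewrite (@expectation_solution t F
  (fun y => a * (sigma2 (phi y) * sigma (phi y)) +
  b * sigma1 (phi y) ^+ 2) t0); last 3 first.
- move=> y; apply: cvgD.
    by apply: cvgM; [exact: cvg_cst|exact: cs2s].
  by apply: cvgM; [exact: cvg_cst|exact: csqr].
- apply: exp_boundedD; (apply: exp_boundedM; first exact: exp_bounded_cst) => //.
- by move=> y; exact: FE.
have i1 : P.-integrable setT
    (EFin \o (fun w => sigma2 (phi (W t w)) * sigma (phi (W t w)))).
  exact: (iW t0 cs2s).
have i2 : P.-integrable setT (EFin \o (fun w => sigma1 (phi (W t w)) ^+ 2)).
  exact: (iW t0 csqr).
rewrite RintegralD//; last 2 first.
- exact: (integrableZl measurableT _ i1).
- exact: (integrableZl measurableT _ i2).
by rewrite RintegralZl// RintegralZl.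
Qed.

Lemma entropy_solution (t : R) : 0 < t ->
  shannon_entropy (X t) (fun x => expR (log_density (t `^ H) x)) =
  (- ln (normal_peak (t `^ H)) + 2^-1 + \int[P]_w G (W t w))%:E.
Proof.
move=> t0; have s0 := tH_neq0 t0; set s := t `^ H in s0 *.
rewrite /shannon_entropy.
pose c := (s ^+ 2 *+ 2)^-1.
pose K y := ln (normal_peak s) - c * y ^+ 2 - G y.
have csqr : continuous (fun y : R => c * y ^+ 2).
  move=> y; apply: cvgM; first exact: cvg_cst.
  by apply: cvgM; exact: cvg_id.
have bsqr : exp_bounded (fun y : R => c * y ^+ 2).
  apply: exp_boundedM; first exact: exp_bounded_cst.
  by apply: exp_boundedM; exact: exp_bounded_id.
have cK : continuous K.
  move=> y; apply: cvgB; last exact: cG.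
  by apply: cvgB; [exact: cvg_cst|exact: csqr].
have bN (F : R -> R) : exp_bounded F -> exp_bounded (fun y => - F y).
  by apply: exp_bounded_le => y; rewrite normrN.
have bK : exp_bounded K.
  apply: exp_boundedD; last exact: bN.
  by apply: exp_boundedD; [exact: exp_bounded_cst|exact: bN].
rewrite (expectation_solution
  (F := fun x => ln (expR (log_density s x))) t0 cK bK); last first.
  by move=> y; rewrite expRK /log_density phiK /K /c -/(G y) [_ / _]mulrC.
rewrite -EFinN; congr EFin.
have iG : P.-integrable setT (EFin \o (fun w => G (W t w))) by exact: iW.
have iS : P.-integrable setT (EFin \o (fun w => c * (W t w) ^+ 2)).
  exact: (iW t0 csqr).
have iY2 : P.-integrable setT (EFin \o (fun w => (W t w) ^+ 2)).
  apply: (iW (K := fun y => y ^+ 2) t0).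
    by move=> y; apply: cvgM; exact: cvg_id.
  by apply: exp_boundedM; exact: exp_bounded_id.
have iC : P.-integrable setT (EFin \o (fun=> ln (normal_peak s))).
  exact: finite_measure_integrable_cst.
have iCS : P.-integrable setT
    (EFin \o (fun w => ln (normal_peak s) - c * (W t w) ^+ 2)).
  by rewrite /comp; under eq_fun do rewrite EFinB; exact: integrableB.
rewrite RintegralB// RintegralB// Rintegral_cst//= probability_setT/= mulr1.
rewrite RintegralZl// W_second_moment// -/s /c.
have -> : (s ^+ 2 *+ 2)^-1 * s ^+ 2 = 2^-1 by field.
by ring.
Qed.

(** Differentiation under the expectation on [`]0, 2[], the derivative in [c]
    being dominated by [M * `|W t|]. *)
Lemma is_derive_mean_G (t : R) : 0 < t ->
  is_derive (1 : R) (1 : R) (fun c => \int[P]_w G (c * W t w))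
    (\int[P]_w (W t w * sigma1 (phi (W t w)))).
Proof.
move=> t0.
pose f c w := G (c * W t w).
have df c w : is_derive c (1 : R) (f^~ w) (W t w * sigma1 (phi (c * W t w))).
  have d1 : is_derive c (1 : R) ( *%R^~ (W t w)) (W t w).
    by apply: is_derive_eq; rewrite scaler0 add0r /GRing.scale/= mulr1.
  have := @is_derive1_comp _ G _ c _ _ (dG _) d1.
  by rewrite mulrC.
have pf c w : partial1of2 f c w = W t w * sigma1 (phi (c * W t w)).
  by rewrite /partial1of2 derive1E (@derive_val _ _ _ _ _ _ _ (df c w)).
have I1 : `]0 : R, 2[%classic 1 by rewrite /= in_itv/= ltr01 ltr1n.
have iF c : `]0 : R, 2[%classic c -> P.-integrable setT (EFin \o f c).
  move=> _; apply: (iW (K := fun y => G (c * y)) t0); last first.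
    exact: exp_bounded_scale.
  move=> y; apply: continuous_comp; last exact: cG.
  by apply: cvgM; [exact: cvg_cst|exact: cvg_id].
have dF c w : `]0 : R, 2[%classic c -> setT w -> derivable (f^~ w) c 1.
  by move=> _ _; case: (df c w).
have M0 : 0 <= M := le_trans (normr_ge0 _) (sigma1M 0).
have iM : P.-integrable setT (EFin \o (fun w => M * `|W t w|)).
  apply: (iW (K := fun y => M * `|y|) t0).
    by move=> y; apply: cvgM; [exact: cvg_cst|exact: norm_continuous].
  apply: exp_boundedM; first exact: exp_bounded_cst.
  by apply: exp_bounded_le (@exp_bounded_id R) => y; rewrite normr_id.
have bM c w : `]0 : R, 2[%classic c -> setT w ->
    `|partial1of2 f c w| <= M * `|W t w|.
  by move=> _ _; rewrite pf normrM mulrC ler_wpM2r.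
have gM w : 0 <= M * `|W t w| by exact: mulr_ge0.
apply: DeriveDef.
  exact: (derivable_under_integral measurableT I1 iF dF gM iM bM).
rewrite -derive1E (differentiation_under_integral measurableT I1 iF dF gM iM bM).
by apply: eq_Rintegral => w _; rewrite pf mul1r.
Qed.

(** [W r] and [(r / t) `^ H *: W t] have the same density. *)
Lemma mean_G_scale (r t : R) : 0 < r -> 0 < t ->
  \int[P]_w G (W r w) = \int[P]_w G (r `^ H / t `^ H * W t w).
Proof.
move=> r0 t0; set c := r `^ H / t `^ H.
have c0 : 0 < c by rewrite divr_gt0 ?powR_gt0.
have cW : has_density (c *: W t : {RV P >-> R}) (normal_pdf 0 (r `^ H)).
  have := W_scale (lt0r_neq0 c0) t0.
  by rewrite gtr0_norm// /c divfK// tH_neq0.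
have mG : measurable_fun setT G by exact: continuous_measurable_fun.
have iG := integrable_normal 0 (tH_neq0 r0) mG bG.
by rewrite (integral_density (W_density r0) mG iG) -(integral_density cW mG iG).
Qed.

Lemma is_derive_ln_peak (t : R) : 0 < t ->
  is_derive t (1 : R) (fun r => - ln (normal_peak (r `^ H))) (H / t).
Proof.
move=> t0; set k := ln (Num.sqrt (pi *+ 2) : R).
have dln : is_derive t (1 : R) (fun r => H * ln r + k) (H / t).
  have dl := is_derive1_ln t0.
  by apply: is_derive_eq; rewrite addr0.
apply: near_eq_is_derive dln.
near=> r; have r0 : 0 < r by near: r; exact: lt_nbhsr.
have s0 : 0 < r `^ H by rewrite powR_gt0.
have pi2 : 0 < pi *+ 2 :> R by rewrite mulrn_wgt0// pi_gt0.
rewrite /normal_peak lnV ?posrE ?sqrtr_gt0 ?mulrn_wgt0 ?mulr_gt0 ?pi_gt0 ?exprn_gt0//.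
rewrite opprK -mulrnAr sqrtrM ?sqr_ge0// sqrtr_sqr gtr0_norm//.
by rewrite lnM ?posrE ?sqrtr_gt0// ln_powR.
Unshelve. all: by end_near. Qed.

Lemma entropy_derivative (t : R) : 0 < t ->
  is_derive t (1 : R)
    (fun r => fine (shannon_entropy (X r)
       (fun x => expR (log_density (r `^ H) x))))
    (H * t `^ (2 * H - 1) * ((t `^ H) ^- 2 +
       \int[P]_w (sigma2 (phi (W t w)) * sigma (phi (W t w))))).
Proof.
move=> t0; have s0 := tH_neq0 t0.
have dc : is_derive t (1 : R) (fun r => r `^ H / t `^ H) (H / t).
  have dp := is_derive1_powR H t0.
  have := is_deriveZ (t `^ H)^-1 dp.
  rewrite (_ : _ \*: _ = (fun r => r `^ H / t `^ H)); last first.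
    by apply/funext => r; rewrite mulrC.
  move=> /is_derive_eq; apply.
  rewrite powRB; last by rewrite (gt_eqF t0) implybT.
  by rewrite powRr1 ?ltW// /GRing.scale/=; field; rewrite s0 gt_eqF.
have dG1 : is_derive (t `^ H / t `^ H) (1 : R) (fun c => \int[P]_w G (c * W t w))
    (\int[P]_w (W t w * sigma1 (phi (W t w)))).
  by rewrite divff//; exact: is_derive_mean_G.
have d1 := @is_derive1_comp _ _ (fun r => r `^ H / t `^ H) t _ _ dG1 dc.
have d2 := is_deriveD (is_deriveD (is_derive_ln_peak t0)
  (is_derive_cst (2^-1 : R) t 1)) d1.
apply: (@near_eq_is_derive _ _ _ _ _ _ _ _ _ (is_derive_eq d2 _)).
  near=> r; have r0 : 0 < r by near: r; exact: lt_nbhsr.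
  by rewrite entropy_solution//= (mean_G_scale r0 t0).
rewrite -W_stein// addr0 powRB; last by rewrite (gt_eqF t0) implybT.
rewrite powRr1 ?ltW// -sqr_powR.
by field; rewrite s0 gt_eqF.
Unshelve. all: by end_near. Qed.

(** [curv] and [corr] stand for [(sigma ^ 2)''] and
    [sigma'' sigma + sigma' ^ 2]; only their values matter, which makes the statement insensitive to the sign of
    the original coefficient. *)
Lemma de_bruijn_positive (f : R -> R -> R) (curv corr : R -> R) :
  (forall t : R, 0 < t -> has_regular_density (X t) (f t)) ->
  (forall x, curv x = 2 * (sigma2 x * sigma x) + 2 * sigma1 x ^+ 2) ->
  (forall x, corr x = sigma2 x * sigma x + sigma1 x ^+ 2) ->
  forall t : R, 0 < t ->
  [/\ shannon_entropy (X t) (f t) \is a fin_num,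
      derivable (fun r => fine (shannon_entropy (X r) (f r))) t 1 &
      ((fun r => fine (shannon_entropy (X r) (f r)))^`()%classic t)%:E =
      ((H * t `^ (2 * H - 1))%:E *
       (fisher_information (fun x => (sigma x ^+ 2)%R) (X t) (f t)
        - 'E_P[fun w => curv (X t w)] + 'E_P[fun w => corr (X t w)]))%E].
Proof.
move=> Xf curvE corrE t t0.
have fE (r : R) : 0 < r -> f r = (fun x => expR (log_density (r `^ H) x)).
  by move=> r0; exact: solution_density_unique r0 (Xf r r0).
have dh := entropy_derivative t0.
have {}dh : is_derive t (1 : R) (fun r => fine (shannon_entropy (X r) (f r)))
    (H * t `^ (2 * H - 1) * ((t `^ H) ^- 2 +
       \int[P]_w (sigma2 (phi (W t w)) * sigma (phi (W t w))))).
  apply: near_eq_is_derive dh; near=> r.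
  by rewrite fE//; near: r; exact: lt_nbhsr.
split; first by rewrite fE// entropy_solution.
  by case: dh.
rewrite derive1E (@derive_val _ _ _ _ _ _ _ dh) fE// fisher_information_solution//.
rewrite (expectation_quadratic t0 curvE).
rewrite (@expectation_quadratic t 1 1 corr t0); last first.
  by move=> x; rewrite corrE !mul1r.
rewrite -EFinB -EFinD -EFinM; congr EFin.
by ring.
Unshelve. all: by end_near. Qed.

End core.

(** * Reduction to a positive coefficient *)

Lemma continuous_neq0_pos (R : realType) (f : R -> R) (x : R) :
  continuous f -> (forall y, f y != 0) -> 0 < f 0 -> 0 < f x.
Proof.
move=> cf f0 f00; rewrite ltNge; apply/negP => fx.
have no_zero a b : a <= b ->
    Num.min (f a) (f b) <= 0 <= Num.max (f a) (f b) -> False.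
  move=> ab /(IVT ab (continuous_subspaceT cf))[c _ /eqP].
  by rewrite (negbTE (f0 c)).
have [x0|/ltW x0] := leP 0 x; apply: (no_zero _ _ x0);
  by rewrite ge_min le_max fx (ltW f00) ?orbT.
Qed.

(** By the intermediate value theorem a sign change would force a zero. *)
Lemma constant_sign (R : realType) (f : R -> R) :
  continuous f -> (forall x, f x != 0) ->
  exists2 eps : R, eps ^+ 2 = 1 & forall x, 0 < eps * f x.
Proof.
move=> cf f0; exists (Num.sg (f 0)); first by rewrite sqr_sg f0.
move=> x; apply: (@continuous_neq0_pos _ (fun x => Num.sg (f 0) * f x)).
- by move=> y; apply: cvgM; [exact: cvg_cst|exact: cf].
- by move=> y; rewrite mulf_neq0// sgr_eq0.
- by rewrite -normrEsg normr_gt0.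
Qed.

Lemma derive1n2_sqr (R : realType) (f : R -> R) (x : R) : smooth f ->
  (fun x => f x ^+ 2)^`(2)%classic x =
  2 * (f^`(2)%classic x * f x) + 2 * f^`()%classic x ^+ 2.
Proof.
move=> sf.
have d0 y : is_derive y (1 : R) f (f^`()%classic y).
  by rewrite derive1E; apply: derivableP; exact: (sf 0%N y).
have d1 y : is_derive y (1 : R) f^`()%classic (f^`(2)%classic y).
  by rewrite /= derive1E; apply: derivableP; exact: (sf 1%N y).
have dsq y : is_derive y (1 : R) (fun y => f y ^+ 2) (2 * (f y * f^`()%classic y)).
  apply: (is_derive_eq (is_deriveX 2 (d0 y))).
  by rewrite /GRing.scale/= expr1; ring.
have -> : (fun x => f x ^+ 2)^`(2)%classic =
    (fun y => 2 * (f y * f^`()%classic y))^`()%classic.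
  rewrite /=; congr (derive1 _); apply/funext => y.
  by rewrite derive1E derive_val.
have d2 := is_deriveZ (2 : R) (is_deriveM (d0 x) (d1 x)).
rewrite derive1E (@derive_val _ _ _ _ _ _ _ d2).
by rewrite /GRing.scale/=; ring.
Qed.

Theorem theorem2p1 (R : realType) (d : measure_display) (T : measurableType d)
    (P : probability T R) (H : R) (B : R -> {RV P >-> R})
    (x0 : R) (sigma : R -> R) (X : R -> {RV P >-> R}) :
  0 < H -> H < 1 ->
  fractional_brownian_motion H B ->
  smooth sigma ->
  bounded_derivatives sigma ->
  (forall x : R, sigma x != 0) ->
  fbm_sde_solution sigma x0 B X ->
  (exists f : R -> R -> R,
     forall t : R, 0 < t -> has_regular_density (X t) (f t)) /\
  (forall f : R -> R -> R,
     (forall t : R, 0 < t -> has_regular_density (X t) (f t)) ->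
     let h : R -> \bar R := fun t : R => shannon_entropy (X t) (f t) in
     let sigma2 : R -> R := fun x : R => sigma x ^+ 2 in
     forall t : R, 0 < t ->
     [/\ h t \is a fin_num,
         derivable (fun s : R => fine (h s)) t 1 &
         ((fun s : R => fine (h s))^`()%classic t)%:E =
         ((H * t `^ (2 * H - 1))%:E *
          (fisher_information sigma2 (X t) (f t)
           - 'E_P[fun w => (sigma2^`(2)%classic (X t w))%R]
           + 'E_P[fun w => (sigma^`(2)%classic (X t w) * sigma (X t w)
                            + (sigma^`()%classic (X t w)) ^+ 2)%R]))%E]).
Proof.
move=> H0 H1 fbmB sm bd sigma_neq0 [phi [_ dphi Xphi]].
have d0 x : is_derive x (1 : R) sigma (sigma^`()%classic x).
  by rewrite derive1E; apply: derivableP; exact: (sm 0%N x).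
have d1 x : is_derive x (1 : R) sigma^`()%classic (sigma^`(2)%classic x).
  by rewrite /= derive1E; apply: derivableP; exact: (sm 1%N x).
have c2 : continuous sigma^`(2)%classic.
  move=> x; apply/differentiable_continuous/derivable1_diffP.
  exact: (sm 2%N x).
have [M1 M1P] := bd 1%N isT.
have [M2 M2P] := bd 2%N isT.
have csigma := is_derive_continuous d0.
have [eps eps2 tau_gt0] := constant_sign csigma sigma_neq0.
have eps_neq0 : eps != 0 by rewrite -sqrf_eq0 eps2 oner_neq0.
have eps_norm : `|eps| = 1.
  by apply/eqP; rewrite -(@eqrXn2 _ 2)// expr1n real_normK ?num_real// eps2.
have epsK (y : R) : eps * (eps * y) = y by rewrite mulrA -expr2 eps2 mul1r.
pose tau x := eps * sigma x.
pose tau1 x := eps * sigma^`()%classic x.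
pose tau2 x := eps * sigma^`(2)%classic x.
pose M := Num.max M1 M2.
pose phi' y := phi (eps * y).
pose W t : {RV P >-> R} := eps *: B t.
have dtau x : is_derive x (1 : R) tau (tau1 x) by exact: is_deriveZ.
have dtau1 x : is_derive x (1 : R) tau1 (tau2 x) by exact: is_deriveZ.
have ctau2 : continuous tau2.
  by move=> x; apply: cvgM; [exact: cvg_cst|exact: c2].
have tau1M x : `|tau1 x| <= M by rewrite normrM eps_norm mul1r le_max M1P.
have tau2M x : `|tau2 x| <= M by rewrite normrM eps_norm mul1r le_max M2P orbT.
have dphi' y : is_derive y (1 : R) phi' (tau (phi' y)).
  have de : is_derive y (1 : R) ( *%R eps) eps.
    have := is_deriveZ eps (is_derive_id y (1 : R)).
    by move=> /is_derive_eq; apply; rewrite /GRing.scale/= mulr1.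
  have := @is_derive1_comp _ phi _ y _ _ (dphi _) de.
  by rewrite mulrC.
have [psi [phiK psiK psi_incr dpsi]] :=
  flow_inverse tau_gt0 (is_derive_continuous dtau) dphi'.
have Wd (t : R) : 0 < t -> has_density (W t) (normal_pdf 0 (t `^ H)).
  move=> t0; have := fbm_scale_density H0 fbmB eps_neq0 t0.
  by rewrite eps_norm mul1r.
have Ws (c t : R) : c != 0 -> 0 < t ->
    has_density (c *: W t : {RV P >-> R}) (normal_pdf 0 (`|c| * t `^ H)).
  move=> c0 t0; have := fbm_scale_density H0 fbmB (mulf_neq0 c0 eps_neq0) t0.
  by rewrite normrM eps_norm mulr1 -scalerA.
have XW (t : R) : 0 < t -> {ae P, forall w, X t w = phi' (W t w)}.
  move=> t0; apply: filterS Xphi => w /(_ t (ltW t0)) ->.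
  by rewrite /phi' /W scale_rvE epsK.
split.
  exists (fun t x => expR (log_density tau psi (t `^ H) x)) => t t0.
  exact: (solution_density Wd XW tau_gt0 dtau phiK psi_incr dpsi t0).
move=> f Xf h sigma2 t t0.
have := de_bruijn_positive (f := f) (curv := sigma2^`(2)%classic)
  (corr := fun x => sigma^`(2)%classic x * sigma x + sigma^`()%classic x ^+ 2)
  Wd Ws XW tau_gt0 dtau dtau1 ctau2 tau1M tau2M dphi' phiK psiK psi_incr dpsi
  Xf.
rewrite (_ : (fun x => tau x ^+ 2) = sigma2); last first.
  by apply/funext => x; rewrite /tau exprMn eps2 mul1r.
apply=> // x.
- rewrite derive1n2_sqr// /tau /tau1 /tau2 exprMn eps2 mul1r.
  by rewrite mulrACA -expr2 eps2 mul1r.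
- rewrite /tau /tau1 /tau2 exprMn eps2 mul1r.
  by rewrite mulrACA -expr2 eps2 mul1r.
Qed.
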